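(* Let $k\ge 2$ be an integer. For each integer $n\ge 0$, let $a(k,n)$ be the number of firings of the start vertex that are needed to return to the critically loaded state in the stochastic abacus process on the complete $k$-ary tree of level $n$, with the root as start vertex. Then $a(k,0)=1$, $a(k,1)=2$, and $$a(k,n)=(k+2)\,a(k,n-1)-k\,a(k,n-2)\qquad\text{for all } n\ge 2.$$
   Context: Complete $k$-ary tree of level $n$ ($n\ge 0$): for $n=0$ it is a single vertex (the root); for $n>0$ it consists of a root joined to the roots of $k$ disjoint subtrees, each a complete $k$-ary tree of level $n-1$. Stochastic abacus on a finite connected undirected graph $G$ with a distinguished start vertex $s$: Replace each undirected edge of $G$ by two oppositely directed edges. For each vertex $v$ of $G$ (an internal vertex) add a terminal vertex $t_v$ and a directed edge $v\to t_v$. Thus the outdegree of the internal vertex $v$ is $\deg_G(v)+1$, and terminal vertices have no outgoing edges. The critical loading places on each internal vertex $v$ a number of chips equal to its outdegree minus one, i.e. $\deg_G(v)$ chips. Terminal vertices start with no chips. The process starts at the critical loading and repeats the following: add one chip to $s$; then, as long as some internal vertex holds at least as many chips as its outdegree, fire such a vertex (it sends one chip along each of its outgoing edges). The order in which vertices are fired does not matter. The process ends the first time, after at least one chip has been added, that the chip contents of the internal vertices are again the critical loading. Chips that reach terminal vertices remain there. *)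

(* Defs.v *)
From mathcomp Require Import all_boot all_order all_algebra.

Set Implicit Arguments.
Unset Strict Implicit.
Unset Printing Implicit Defensive.

(* Complete k-ary trees. At level m.+1, None is the root and Some (i, v) is the
   vertex v of the i-th of the k disjoint subtrees of level m. *)
Fixpoint ktree (k n : nat) : finType :=
  if n is m.+1 then option ('I_k * ktree k m)%type else unit.

Definition ktree_root (k n : nat) : ktree k n :=
  match n with
  | 0 => tt
  | m.+1 => None
  end.

Fixpoint ktree_edge (k n : nat) : rel (ktree k n) :=
  match n return rel (ktree k n) with
  | 0 => fun _ _ => false
  | m.+1 => fun x y : option ('I_k * ktree k m) =>
      match x, y with
      | None, None => false
      | None, Some (_, v) => v == ktree_root k m
      | Some (_, u), None => u == ktree_root k m
      | Some (i, u), Some (j, v) => (i == j) && ktree_edge u v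
      end
  end.

Lemma ktree_edge_irr (k n : nat) : irreflexive (@ktree_edge k n).
Proof. by elim: n => [|n IHn] //= [[i u]|] //=; rewrite IHn andbF. Qed.

Lemma ktree_edge_sym (k n : nat) : symmetric (@ktree_edge k n).
Proof.
by elim: n => [|n IHn] //= [[i u]|] [[j v]|] //=; rewrite eq_sym IHn.
Qed.

Section StochasticAbacus.

(* An undirected simple graph is given by its (symmetric, irreflexive)
   adjacency relation e; s is the start vertex. *)
Variables (T : finType) (e : rel T) (s : T).

(* In T + T, inl v is the internal vertex v and inr v the terminal vertex t_v *)
Definition abacus_edge : rel (T + T) := fun x y =>
  match x, y with
  | inl u, inl v => e u v
  | inl u, inr v => u == v
  | inr _, _ => false
  end.

Definition outdeg (x : T + T) : nat := #|[set y | abacus_edge x y]|.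

Definition chips : Type := {ffun T + T -> nat}.

Definition critical : chips :=
  [ffun x => if x is inl _ then outdeg x - 1 else 0].

Definition add_start (c : chips) : chips := [ffun x => c x + (x == inl s)].

Definition can_fire (c : chips) (v : T) : bool := outdeg (inl v) <= c (inl v).

(* The subtraction is truncated; it is only used when can_fire c v holds. *)
Definition fire (v : T) (c : chips) : chips :=
  [ffun x => c x - (if x == inl v then outdeg x else 0) + abacus_edge (inl v) x].

Definition returned (c : chips) : bool :=
  [forall v, c (inl v) == critical (inl v)].

(* abacus_run c m: some execution of the process, not stopped before c, reaches
   the state c (with at least one chip added) after m firings of s. The
   premises ~~ returned c stop the process at the first return. *)
Inductive abacus_run : chips -> nat -> Prop :=
| abacus_first : abacus_run (add_start critical) 0
| abacus_fire c m v :
    abacus_run c m -> ~~ returned c -> can_fire c v ->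
    abacus_run (fire v c) (m + (v == s))
| abacus_add c m :
    abacus_run c m -> ~~ returned c -> (forall v, ~~ can_fire c v) ->
    abacus_run (add_start c) m.

(* m is the number of firings of s needed to return: the process can be run to
   its end, and s is fired m times whatever the order of the firings. *)
Definition start_firings (m : nat) : Prop :=
  (exists2 c, abacus_run c m & returned c) /\
  (forall c m', abacus_run c m' -> returned c -> m' = m).

End StochasticAbacus.

(* Main.v *)
Require Import Defs.
From mathcomp Require Import all_boot all_order all_algebra.
From mathcomp Require Import zify ring.

Set Implicit Arguments.
Unset Strict Implicit.
Unset Printing Implicit Defensive.

Import Order.TTheory GRing.Theory Num.Theory.

(** Let [L] be the Laplacian of the graph, plus the identity (the contribution
    of the terminal edges). After [N] chips have been added and every vertex [v]
    has been fired [u v] times, the internal loading is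
    [critical + N * delta_s - L u]. Suppose that [w] is a vector of natural
    numbers with [L w = N0 * delta_s], [N0 > 0], taking the value [1] somewhere.
    As long as [N <= N0], no vertex can be fired more than [w] prescribes
    (least action). A stable loading is at most [critical], so [L u >= N *
    delta_s], and the maximum principle for [L] gives [u >= w] when [N = N0]:
    the process returns with [u = w] at the latest. At any return, [u] is
    proportional to [w], and the entry [1] of [w] forces [u = w]. So the start
    vertex is fired [w s] times.
    On the complete [k]-ary tree, [w] depends only on the height of the vertex,
    is [1] at the leaves, and [L w = 0] off the root is the recurrence. *)

(** * The Laplacian and its maximum principle *)

Section Laplacian.

Local Open Scope ring_scope.

Variables (T : finType) (e : rel T).

Definition laplacian (f : T -> int) (v : T) : int :=
  f v + \sum_(w | e v w) (f v - f w).

Lemma laplacianD (f g : T -> int) (v : T) :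
  laplacian (fun x => f x + g x) v = laplacian f v + laplacian g v.
Proof.
rewrite /laplacian addrACA; congr (_ + _); rewrite -big_split /=.
by apply: eq_bigr => w _; ring.
Qed.

Lemma laplacianZ (a : int) (f : T -> int) (v : T) :
  laplacian (fun x => a * f x) v = a * laplacian f v.
Proof.
rewrite /laplacian mulrDr mulr_sumr; congr (_ + _).
by apply: eq_bigr => w _; ring.
Qed.

Lemma laplacianB (f g : T -> int) (v : T) :
  laplacian (fun x => f x - g x) v = laplacian f v - laplacian g v.
Proof.
rewrite -[in RHS]mulN1r -laplacianZ -laplacianD.
by rewrite /laplacian; congr (_ + _); [ring | apply: eq_bigr => w _; ring].
Qed.

Lemma eq_laplacian (f g : T -> int) : f =1 g -> laplacian f =1 laplacian g.
Proof.
move=> fg v; rewrite /laplacian fg; congr (_ + _).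
by apply: eq_bigr => w _; rewrite fg.
Qed.

(** Where [f] is maximal every difference in the sum is nonnegative, so the maximum is at most the
    Laplacian there. *)
Lemma laplacian_le0 (f : T -> int) :
  (forall v, laplacian f v <= 0) -> forall v, f v <= 0.
Proof.
move=> fle v.
have [x _ xmax] := @Order.TotalTheory.arg_maxP _ _ T v predT f isT.
apply: le_trans (xmax v isT) _; apply: le_trans (fle x).
rewrite /laplacian lerDl sumr_ge0 // => w _.
by rewrite subr_ge0; apply: xmax.
Qed.

Lemma laplacian_le (f g : T -> int) :
  (forall v, laplacian f v <= laplacian g v) -> forall v, f v <= g v.
Proof.
move=> fg v; rewrite -subr_le0.
apply: (laplacian_le0 (f := fun x => f x - g x)) => x.
by rewrite laplacianB subr_le0.
Qed.

Lemma laplacian_inj (f g : T -> int) :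
  laplacian f =1 laplacian g -> f =1 g.
Proof.
move=> fg v; apply/le_anti/andP.
by split; apply: laplacian_le => x; rewrite fg.
Qed.

Lemma outdeg_inl (v : T) : outdeg e (inl v) = (\sum_(w | e v w) 1).+1%N.
Proof.
rewrite /outdeg cardsE -sum1_card big_sumType /=.
rewrite [X in (_ + X)%N](big_pred1 v) => [|w]; first by rewrite addn1.
by rewrite inE /= eq_sym.
Qed.

(** This is the amount that one firing of [v] removes from the loading of [x]. *)
Lemma laplacian_delta (v x : T) : irreflexive e -> symmetric e ->
  laplacian (fun y => (y == v)%:Z) x
    = (if x == v then (outdeg e (inl x))%:Z else 0) - (e v x)%:Z.
Proof.
move=> eirr esym; rewrite /laplacian outdeg_inl.
case: eqVneq => [->|xv].
  rewrite eirr subr0 (eq_bigr (fun=> 1)) => [|w vw]; last first.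
    by case: eqVneq vw => [->|//]; rewrite eirr.
  by rewrite sum1_card sumr_const; lia.
rewrite !add0r esym; under eq_bigr do rewrite sub0r.
rewrite sumrN; congr (- _).
case xv': (e x v).
  rewrite (bigD1 v) //= eqxx big1 ?addr0 // => w /andP[_ /negPf->].
  by [].
by rewrite big1 // => w; case: eqVneq => [->|//]; rewrite xv'.
Qed.

End Laplacian.

(** * Firing counts along an execution, bounded by [w] *)

Section Odometer.

Local Open Scope ring_scope.

Variables (T : finType) (e : rel T) (s : T).
Hypotheses (eirr : irreflexive e) (esym : symmetric e).

Variables (w : T -> nat) (N0 : nat).
Hypothesis N0_gt0 : (0 < N0)%N.
Hypothesis lap_w : forall v,
  laplacian e (fun x => (w x)%:Z) v = ((v == s) * N0)%N%:Z.

Definition odometer (c : chips T) (u : T -> nat) (N : nat) : Prop :=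
  forall v, (c (inl v))%:Z
    = (critical e (inl v))%:Z + ((v == s) * N)%N%:Z
      - laplacian e (fun x => (u x)%:Z) v.

Lemma criticalS (v : T) : (critical e (inl v)).+1 = outdeg e (inl v).
Proof. by rewrite ffunE outdeg_inl subn1. Qed.

Lemma odometer_first : odometer (add_start s (critical e)) (fun=> 0%N) 1.
Proof.
move=> v; rewrite ffunE muln1 PoszD; set z := laplacian _ _ _.
have -> : z = 0; last by rewrite subr0.
by rewrite /z /laplacian big1.
Qed.

Lemma odometer_add (c : chips T) (u : T -> nat) (N : nat) :
  odometer c u N -> odometer (add_start s c) u N.+1.
Proof.
move=> cu v; rewrite ffunE PoszD cu.
by rewrite (_ : (inl v == inl s) = (v == s)) // mulnS PoszD; lia.
Qed.

Lemma odometer_fire (c : chips T) (u : T -> nat) (N : nat) (v : T) :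
  odometer c u N -> can_fire e c v ->
  odometer (fire e v c) (fun x => u x + (x == v))%N N.
Proof.
move=> cu cv x; rewrite ffunE.
under eq_laplacian do rewrite PoszD.
rewrite laplacianD laplacian_delta // (_ : (inl x == inl v) = (x == v)) //=.
(* The hypothesis [cv] makes the truncated subtraction in [fire] exact. *)
move: cv (cu x); rewrite /can_fire; move: (laplacian _ _ _) => z.
by case: (eqVneq x v) => [->|_] cv cux; lia.
Qed.

(** If [u] and [w] agree at [v] while [u] is at most [w] elsewhere, the Laplacian of [u] at [v] is
    at least that of [w]. As [N <= N0], the load of [v] is then at most critical. *)
Lemma odometer_fire_lt (c : chips T) (u : T -> nat) (N : nat) (v : T) :
  odometer c u N -> (forall x, u x <= w x)%N -> (N <= N0)%N ->
  can_fire e c v -> (u v < w v)%N.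
Proof.
move=> cu uw NN0; apply: contraTT; rewrite -leqNgt => wv.
rewrite /can_fire -criticalS -leqNgt.
have uwv : u v = w v by apply/eqP; rewrite eqn_leq uw wv.
suff : laplacian e (fun x => (w x)%:Z) v <= laplacian e (fun x => (u x)%:Z) v.
  have := cu v; rewrite lap_w; case: (v == s); lia.
rewrite /laplacian uwv lerD2l ler_sum // => x _; have := uw x; lia.
Qed.

Lemma odometer_stable (c : chips T) (u : T -> nat) :
  odometer c u N0 -> (forall x, u x <= w x)%N ->
  (forall v, ~~ can_fire e c v) -> returned e c.
Proof.
move=> cu uw stable; apply/forallP => v; apply/eqP.
have uwE : (fun x => (u x)%:Z) =1 (fun x => (w x)%:Z).
  move=> x; apply/eqP; rewrite eq_le lez_nat uw /=.
  move: x; apply: (laplacian_le (e := e)) => y.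
  rewrite lap_w; have := cu y; have := stable y.
  by rewrite /can_fire -criticalS; lia.
by have := cu v; rewrite (eq_laplacian e uwE) lap_w addrK => -[].
Qed.

Definition bounded_odometer (c : chips T) (u : T -> nat) (N : nat) : Prop :=
  [/\ odometer c u N, forall x, (u x <= w x)%N & (0 < N <= N0)%N].

Lemma bounded_odometer_first :
  bounded_odometer (add_start s (critical e)) (fun=> 0%N) 1.
Proof. by split=> //; apply: odometer_first. Qed.

Lemma bounded_odometer_fire (c : chips T) (u : T -> nat) (N : nat) (v : T) :
  bounded_odometer c u N -> can_fire e c v ->
  bounded_odometer (fire e v c) (fun x => u x + (x == v))%N N.
Proof.
move=> [cu uw /andP[N_gt0 NN0]] cv; split; last by rewrite N_gt0.
  exact: odometer_fire.
move=> x; case: eqVneq => [->|_]; last by rewrite addn0.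
by rewrite addn1 (odometer_fire_lt cu).
Qed.

Lemma bounded_odometer_add (c : chips T) (u : T -> nat) (N : nat) :
  bounded_odometer c u N -> ~~ returned e c -> (forall v, ~~ can_fire e c v) ->
  bounded_odometer (add_start s c) u N.+1.
Proof.
move=> [cu uw /andP[N_gt0 NN0]] cN stable; split=> //.
  exact: odometer_add.
(* A stable state with [N = N0] has returned, so no further chip is added. *)
rewrite /= ltn_neqAle NN0 andbT; apply: contraNneq cN => NE.
by apply: odometer_stable stable => //; rewrite -NE.
Qed.

Lemma abacus_run_odometer (c : chips T) (m : nat) :
  abacus_run e s c m -> exists u N, bounded_odometer c u N /\ u s = m.
Proof.
elim=> {c m} [|c m v _ [u [N [cuN um]]] _ cv|c m _ [u [N [cuN um]]] cN stable].
- by exists (fun=> 0%N), 1%N; split=> //; apply: bounded_odometer_first.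
- exists (fun x => u x + (x == v))%N, N; split; last by rewrite um eq_sym.
  exact: bounded_odometer_fire.
- by exists u, N.+1; split=> //; apply: bounded_odometer_add.
Qed.

(** Termination measure: each firing or addition raises the total of firings and added chips by one,
    and a state that has not returned always admits one of the two. *)
Lemma abacus_run_long (j : nat) :
  (exists c m, abacus_run e s c m /\ returned e c) \/
  (exists c m u N, [/\ abacus_run e s c m, bounded_odometer c u N
                     & (j <= \sum_x u x + N)%N]).
Proof.
elim: j => [|j [|[c [m [u [N [run cuN jN]]]]]]]; [right | by left |].
  exists (add_start s (critical e)), 0%N, (fun=> 0%N), 1%N; split=> //.
    exact: abacus_first.
  exact: bounded_odometer_first.
have [cR|cN] := boolP (returned e c); first by left; exists c, m.
right; have [v cv|stable] := pickP (can_fire e c).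
  exists (fire e v c), (m + (v == s))%N, (fun x => u x + (x == v))%N, N; split.
  - exact: abacus_fire.
  - exact: bounded_odometer_fire.
  rewrite big_split /= (bigD1 v) //= [X in (_ + X + N)%N](bigD1 v) //= eqxx.
  by move: jN; rewrite (bigD1 v) //=; lia.
have stable' v : ~~ can_fire e c v by rewrite stable.
exists (add_start s c), m, u, N.+1; split.
- exact: abacus_add.
- exact: bounded_odometer_add.
- by rewrite addnS.
Qed.

Lemma abacus_run_returned : exists2 c, exists m, abacus_run e s c m & returned e c.
Proof.
(* The bounds [u <= w] and [N <= N0] cap the measure just below this value. *)
have [[c [m [run cR]]]|] := abacus_run_long (\sum_x w x + N0).+1.
  by exists c => //; exists m.
move=> [c [m [u [N [_ [_ uw /andP[_ NN0]]]]]]].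
by rewrite ltnNge leq_add // leq_sum.
Qed.

Lemma returned_odometer (c : chips T) (u : T -> nat) (N : nat) (l : T) :
  w l = 1%N -> bounded_odometer c u N -> returned e c -> u =1 w.
Proof.
move=> wl [cu uw /andP[N_gt0 NN0]] /forallP cR.
have lap_u v : laplacian e (fun x => (u x)%:Z) v = ((v == s) * N)%N%:Z.
  by have := cu v; rewrite (eqP (cR v)); lia.
have prop : (fun x => N0%:Z * (u x)%:Z) =1 (fun x => N%:Z * (w x)%:Z).
  by apply: (laplacian_inj (e := e)) => v; rewrite !laplacianZ lap_u lap_w; lia.
(* At [l] the proportionality reads [N0 * u l = N] with [0 < N <= N0], so [u l = 1]. *)
have NE : N = N0.
  by have := prop l; have := uw l; rewrite wl; case: (u l) => [|[|?]]; lia.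
have N0_neq0 : N0%:Z != 0 by rewrite eqz_nat -lt0n.
by move=> x; have := prop x; rewrite NE => /(mulfI N0_neq0)[].
Qed.

Lemma start_firings_laplacian (l : T) : w l = 1%N -> start_firings e s (w s).
Proof.
move=> wl; have runE c m : abacus_run e s c m -> returned e c -> m = w s.
  move=> /abacus_run_odometer[u [N [cuN <-]]] cR.
  exact: (returned_odometer wl cuN cR).
split=> //; have [c [m run] cR] := abacus_run_returned.
by exists c => //; rewrite -(runE c m).
Qed.

End Odometer.

(** * The weights on the complete tree *)

Section Tree.

Variable k : nat.

(* The weight of the vertices of height n, with its increment to height n.+1. *)
Fixpoint height_weights (n : nat) : nat * nat :=
  if n is m.+1 then
    let: (h, d) := height_weights m in (h + d, h + d + k * d)
  else (1, 1).

Definition height_weight (n : nat) : nat := (height_weights n).1.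

Fixpoint tree_weight (n : nat) : ktree k n -> nat :=
  match n return ktree k n -> nat with
  | 0 => fun=> 1
  | m.+1 => fun x : option ('I_k * ktree k m) =>
      if x is Some (_, v) then tree_weight v else height_weight m.+1
  end.

Lemma tree_weight_root (n : nat) :
  tree_weight (ktree_root k n) = height_weight n.
Proof. by case: n. Qed.

Lemma tree_weight_leaf (n : nat) :
  0 < k -> exists l : ktree k n, tree_weight l = 1.
Proof.
move=> k_gt0; elim: n => [|n [l wl]]; first by exists tt.
by exists (Some (Ordinal k_gt0, l)).
Qed.

(** The increment also serves as [N0], the number of chips added before the return. *)
Lemma height_weights2_gt0 (n : nat) : 0 < (height_weights n).2.
Proof.
elim: n => [|n] //=; case: (height_weights n) => h d /= d_gt0.
by rewrite -addnA addn_gt0 addn_gt0 d_gt0 orbT.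
Qed.

Lemma height_weightS (n : nat) :
  height_weight n.+1 = height_weight n + (height_weights n).2.
Proof. by rewrite /height_weight /=; case: (height_weights n). Qed.

Lemma height_weights2S (n : nat) :
  (height_weights n.+1).2 = height_weight n.+1 + k * (height_weights n).2.
Proof. by rewrite /height_weight /=; case: (height_weights n). Qed.

Lemma big_option (I : finType) (P : pred (option I)) (F : option I -> int) :
  (\sum_(x | P x) F x
    = (if P None then F None else 0) + \sum_(i | P (Some i)) F (Some i))%R.
Proof.
rewrite big_mkcond (bigD1 None) //=; congr (_ + _)%R.
rewrite [RHS]big_mkcond /=.
rewrite (reindex_omap Some id) /=; last by case.
by apply: eq_bigl => i; rewrite eqxx.
Qed.

(** Going up one level, each subtree root gains a neighbour heavier by exactly its old Laplacian,
    which cancels it. The new root has [k] children, each lighter by the old increment. *)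
Lemma laplacian_tree_weight (n : nat) (x : ktree k n) :
  (laplacian (@ktree_edge k n) (fun y => (tree_weight y)%:Z) x
    = ((x == ktree_root k n) * (height_weights n).2)%N%:Z)%R.
Proof.
elim: n x => [|n IHn] x; first by case: x; rewrite /laplacian big1.
rewrite /laplacian big_option; case: x => [[i u]|] /=.
  rewrite mul0n addrCA.
  (* Edges avoiding the new root stay inside the [i]-th subtree. *)
  rewrite [X in (_ + (_ + X))%R](_ : _ = \sum_(v | ktree_edge u v)
    ((tree_weight u)%:Z - (tree_weight v)%:Z))%R.
    have := IHn u; rewrite /laplacian => ->.
    case: eqVneq => [->|_]; last by rewrite mul0n addr0.
    by rewrite tree_weight_root height_weightS; lia.
  rewrite (eq_bigl (fun p => (i == p.1) && ktree_edge u p.2)); last by case.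
  rewrite (eq_bigr (fun p => (tree_weight u)%:Z - (tree_weight p.2)%:Z)%R);
    last by case.
  rewrite -(pair_big_dep (fun j => i == j) (fun j v => ktree_edge u v)
    (fun j v => (tree_weight u)%:Z - (tree_weight v)%:Z)%R) /=.
  by rewrite (big_pred1 i) // => j; rewrite eq_sym.
rewrite mul1n height_weights2S add0r PoszD; congr (_ + _)%R.
rewrite (eq_bigl (fun p : 'I_k * ktree k n => true && (p.2 == ktree_root k n)));
  last by case.
rewrite (eq_bigr (fun p => (height_weight n.+1)%:Z - (tree_weight p.2)%:Z)%R);
  last by case.
rewrite -(pair_big predT (fun v => v == ktree_root k n)
  (fun _ v => (height_weight n.+1)%:Z - (tree_weight v)%:Z)%R) /=.
rewrite (eq_bigr (fun=> (height_weights n).2%:Z)%R) => [|j _].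
  by rewrite sumr_const card_ord; lia.
by rewrite big_pred1_eq tree_weight_root height_weightS; lia.
Qed.

Lemma start_firings_ktree (n : nat) : 0 < k ->
  start_firings (@ktree_edge k n) (ktree_root k n) (height_weight n).
Proof.
move=> k_gt0; have [l wl] := tree_weight_leaf n k_gt0.
rewrite -tree_weight_root.
apply: (start_firings_laplacian (@ktree_edge_irr k n) (@ktree_edge_sym k n)
  (height_weights2_gt0 n) (@laplacian_tree_weight n) wl).
Qed.

End Tree.

Theorem mainTheorem5 (k : nat) (hk : 2 <= k) :
  exists a : nat -> nat,
    (forall n, start_firings (@ktree_edge k n) (ktree_root k n) (a n)) /\
    a 0 = 1 /\
    a 1 = 2 /\
    (forall n, 2 <= n ->
      ((a n)%:Z = (k%:Z + 2) * (a (n - 1)%N)%:Z - k%:Z * (a (n - 2)%N)%:Z)%R).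
Proof.
exists (height_weight k); split.
  by move=> n; apply: start_firings_ktree; apply: ltnW.
do 2!split=> //; case=> [|[|n]] // _; rewrite subn1 subn2 /=.
(* With [h] the weights and [d] the increments, [h(n+2) = 2 h(n+1) + k d(n)] and
   [d(n) = h(n+1) - h(n)]. *)
rewrite (height_weightS k n.+1) height_weights2S (height_weightS k n) !PoszD.
by rewrite PoszM; ring.
Qed.
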